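(* Let $\mathbb{F}\in\{\mathbb{R},\mathbb{C}\}$. There exist constants $c>0$ and $\gamma>0$ such that the following holds for all positive integers $n,m$ with $m\ge c\,n\log n$ and every $\mathbf{x}_0\in\mathbb{F}^n$. Let $\mathbf{z}_1,\dots,\mathbf{z}_m$ be independent random vectors, each uniformly distributed on the unit sphere of $\mathbb{F}^n$, and let $\mathbf{b}=A(\mathbf{x}_0)$. Then, with probability at least $1-e^{-\gamma m/n}$, the only solutions $\mathbf{x}\in\mathbb{F}^n$ of $A(\mathbf{x})=\mathbf{b}$ are the vectors $e^{i\phi}\mathbf{x}_0$ (with $\phi\in[0,2\pi)$ if $\mathbb{F}=\mathbb{C}$, and $e^{i\phi}\in\{1,-1\}$ if $\mathbb{F}=\mathbb{R}$).
   Context: The (nonlinear) map $A:\mathbb{F}^n\to\mathbb{R}^m$ is given by $A(\mathbf{x})_i=|\langle\mathbf{x},\mathbf{z}_i\rangle|^2$ for $i=1,\dots,m$. *)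

(* Defs.v *)
From HB Require Import structures.
From mathcomp Require Import all_boot all_order all_algebra.
From mathcomp Require Import all_classical all_reals all_analysis.
From mathcomp Require Import complex.

Set Implicit Arguments.
Unset Strict Implicit.
Unset Printing Implicit Defensive.

Import Order.TTheory GRing.Theory Num.Theory.
Import numFieldNormedType.Exports.

Local Open Scope classical_set_scope.
Local Open Scope ring_scope.

Variant scalar_kind := RealScalars | ComplexScalars.

(* Landing in numFieldType gives both R and R[i] the topology of their
   absolute value, hence matrices over them the usual topology. *)
Definition scal (R : realType) (k : scalar_kind) : numFieldType :=
  match k with RealScalars => R | ComplexScalars => R[i] end.

Definition conj_scal (R : realType) (k : scalar_kind) : scal R k -> scal R k :=
  match k with
  | RealScalars => fun a => a
  | ComplexScalars => fun a => conjc a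
  end.

(* The absolute value as an element of R: the MathComp norm `|a| on R[i] is
   valued in R[i] itself. *)
Definition abs_scal (R : realType) (k : scalar_kind) : scal R k -> R :=
  match k with
  | RealScalars => fun a => `|a|
  | ComplexScalars => fun a => ComplexField.Normc.normc a
  end.

Definition phases (R : realType) (k : scalar_kind) : set (scal R k) :=
  match k with
  | RealScalars => [set 1; -1]
  | ComplexScalars =>
      [set Complex (cos phi) (sin phi) | phi in [set phi | 0 <= phi < 2 * pi]]
  end.

Definition inner (R : realType) (k : scalar_kind) (n : nat)
    (x z : 'cV[scal R k]_n) : scal R k :=
  \sum_(j < n) x j ord0 * conj_scal (z j ord0).

Definition phaseless_map (R : realType) (k : scalar_kind) (n m : nat)
    (z : 'I_m -> 'cV[scal R k]_n) (x : 'cV[scal R k]_n) : 'cV[R]_m :=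
  \col_(i < m) abs_scal (inner x (z i)) ^+ 2.

Definition unit_sphere (R : realType) (k : scalar_kind) (n : nat) :
    set 'cV[scal R k]_n :=
  [set z | \sum_(j < n) abs_scal (z j ord0) ^+ 2 = 1].

(* Orthogonal over the reals, unitary over the complex numbers. *)
Definition unitary (R : realType) (k : scalar_kind) (n : nat)
    (U : 'M[scal R k]_n) : Prop :=
  U *m (map_mx (@conj_scal R k) U)^T = 1%:M.

(* The space of column vectors with its Borel sigma-algebra. *)
Definition borel_vec (R : realType) (k : scalar_kind) (n : nat) :=
  g_sigma_algebraType (@open 'cV[scal R k]_n).

(* The uniform law (normalized surface measure) on the unit sphere is the Borel
   probability measure carried by the sphere and invariant under the orthogonal,
   resp. unitary, group; it is unique since this compact group acts transitively
   on the sphere.  The set [set z | B (U *m z)] is the preimage of B under U. *)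
Definition uniform_on_sphere (d : measure_display) (Om : measurableType d)
    (R : realType) (P : probability Om R) (k : scalar_kind) (n : nat)
    (Z : {RV P >-> borel_vec R k n}) : Prop :=
  distribution P Z (@unit_sphere R k n) = 1%E /\
  forall (U : 'M[scal R k]_n) (B : set (borel_vec R k n)),
    unitary U -> measurable B ->
    distribution P Z [set z | B (U *m z)] = distribution P Z B.

Definition mutually_independent (d d' : measure_display)
    (Om : measurableType d) (T : measurableType d') (R : realType)
    (P : probability Om R) (m : nat) (Z : 'I_m -> {RV P >-> T}) : Prop :=
  forall (J : {set 'I_m}) (B : 'I_m -> set T),
    (forall i, measurable (B i)) ->
    P (\bigcap_(i in [set` J]) (Z i @^-1` B i)) =
    (\prod_(i in J) P (Z i @^-1` B i))%E.

(* Main.v *)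
Require Import Defs.
From HB Require Import structures.
From mathcomp Require Import all_boot all_order all_algebra.
From mathcomp Require Import all_classical all_reals all_analysis.
From mathcomp Require Import complex.
From mathcomp Require Import measurable_realfun.
From mathcomp Require Import ring lra.
Set Implicit Arguments.
Unset Strict Implicit.
Unset Printing Implicit Defensive.
Import Order.TTheory GRing.Theory Num.Theory.
Import numFieldNormedType.Exports.
Local Open Scope classical_set_scope.
Local Open Scope ring_scope.

(** For [n >= 2] the hypothesis on [m] gives [m > 24 n], and this many measurements
    recover all vectors [x0] at once, almost surely.

    Suppose that [x] and [x0] have the same measurements. Rotating [x] by a phase,
    one may take [<x, x0>] real. With [a = x - x0] and [b = x + x0], polarization
    gives [Re (<a, z_i> conj <b, z_i>) = 0] for all [i], where [<a, b>] is real.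
    So it is enough that no pair of unit vectors [a], [b] with [<a, b>] real makes
    all the numbers [cross a b z_i = Re (<a, z_i> conj <b, z_i>)] vanish: then
    [a = 0] or [b = 0], which is recovery up to phase ([separating_recovery]).

    Such pairs live in a set with [4 n] real coordinates. If a single measurement
    has [|cross a b z| <= eps] with probability [O (eps ^ (1/6))], uniformly in the
    pair, then a net of mesh about [eps] leaves, by independence and the union
    bound, a probability of failure [O (eps ^ (m/6 - 4 n))], which tends to [0] with
    [eps] when [m > 24 n]. Below, [eps] is of order [M ^ -6], where [M] is an integer
    that is sent to infinity ([cross_cover], [net_beats_small_ball],
    [separating_whp]).

    The law of [z] is given only through its invariance under unitary maps, so both
    small-ball estimates come from double counting: transporting an event by a
    finite family of unitary maps gives events of equal mass, and if no point of
    the sphere lies in more than a small proportion of them, that mass is small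
    ([double_counting]).
    - For the slab [|<a, z>| <= delta], the unitary maps move [a] to the normalized
      vectors of the grid [{1, ..., M}^n]. Each line of the grid parallel to a
      suitable axis meets the slab at most once, which gives the bound [1 / M]
      ([slab_small]).
    - For [cross a b] over the complex numbers, the unitary maps change the phase of
      the component of [z] along [a]. Along this orbit [cross a b] has the form
      [A + Re (u X)] with [|u| = 1] and [|A| + |X| >= |<a, z>| |<b, z>|]; at rational
      points of the circle with integer parameters it is a quadratic polynomial up
      to a positive factor, so outside the slabs of [a] and [b] it is small for at
      most two parameters ([cross_small_complex]). Over the reals [cross a b] is the
      product of the two inner products and the slabs suffice ([cross_small_real]). *)

(** * Coordinates of real and complex scalars *)

Definition re (R : realType) (k : scalar_kind) : scal R k -> R :=
  match k with
  | RealScalars => fun a => a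
  | ComplexScalars => fun a => complex.Re a
  end.

Definition im (R : realType) (k : scalar_kind) : scal R k -> R :=
  match k with
  | RealScalars => fun=> 0
  | ComplexScalars => fun a => complex.Im a
  end.

Definition emb (R : realType) (k : scalar_kind) : R -> scal R k :=
  match k with
  | RealScalars => fun a => a
  | ComplexScalars => fun a => Complex a 0
  end.
Arguments emb {R} k.

Section Scalars.
Variables (R : realType) (k : scalar_kind).
Local Notation F := (scal R k).
Implicit Types (x y : F) (r s : R).

Lemma re_additive : {morph @re R k : x y / x - y}.
Proof. by case: k => // -[a b] [c d]. Qed.

Lemma im_additive : {morph @im R k : x y / x - y}.
Proof. by case: k => [x y|[a b] [c d]] //=; rewrite subrr. Qed.

Lemma conj_scal_additive : {morph @conj_scal R k : x y / x - y}.
Proof. by case: k => // x y; exact: rmorphB. Qed.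

Lemma conj_scal_monoid : monoid_morphism (@conj_scal R k).
Proof.
by case: k; split => //; [exact: (rmorph1 (@conjc R))|exact: (rmorphM (@conjc R))].
Qed.

HB.instance Definition _ := GRing.isZmodMorphism.Build F R (@re R k) re_additive.
HB.instance Definition _ := GRing.isZmodMorphism.Build F R (@im R k) im_additive.
HB.instance Definition _ :=
  GRing.isZmodMorphism.Build F F (@conj_scal R k) conj_scal_additive.
HB.instance Definition _ :=
  GRing.isMonoidMorphism.Build F F (@conj_scal R k) conj_scal_monoid.

Lemma scal_ext x y : re x = re y -> im x = im y -> x = y.
Proof. by case: k x y => [//|] [a b] [c d] /= -> ->. Qed.

Lemma reM x y : re (x * y) = re x * re y - im x * im y.
Proof. by case: k x y => [x y|[a b] [c d]] //=; rewrite mulr0 subr0. Qed.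

Lemma imM x y : im (x * y) = re x * im y + im x * re y.
Proof. by case: k x y => [x y|[a b] [c d]] //=; rewrite mulr0 mul0r addr0. Qed.

Lemma re_conj x : re (conj_scal x) = re x.
Proof. by case: k x => // -[]. Qed.

Lemma im_conj x : im (conj_scal x) = - im x.
Proof. by case: k x => [x|[a b]] //=; rewrite oppr0. Qed.

Lemma re_emb r : re (emb k r) = r. Proof. by case: k. Qed.

Lemma im_emb r : im (emb k r) = 0. Proof. by case: k. Qed.

Lemma re1 : re (1 : F) = 1. Proof. by case: k. Qed.

Lemma im1 : im (1 : F) = 0. Proof. by case: k. Qed.

Lemma reD x y : re (x + y) = re x + re y. Proof. exact: raddfD. Qed.

Lemma imD x y : im (x + y) = im x + im y. Proof. exact: raddfD. Qed.

Lemma reN x : re (- x) = - re x. Proof. exact: raddfN. Qed.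

Lemma imN x : im (- x) = - im x. Proof. exact: raddfN. Qed.

Lemma re0 : re (0 : F) = 0. Proof. exact: raddf0. Qed.

Lemma im0 : im (0 : F) = 0. Proof. exact: raddf0. Qed.

Definition scalE := (re_emb, im_emb, reM, imM, re_conj, im_conj,
  (re1, im1, re0, im0), (reD, imD, reN, imN)).

Lemma emb0 : emb k (0 : R) = 0. Proof. by case: k. Qed.

Lemma emb1 : emb k (1 : R) = 1. Proof. by case: k. Qed.

Lemma embM r s : emb k (r * s) = emb k r * emb k s.
Proof. by apply: scal_ext; rewrite !scalE; ring. Qed.

Lemma emb_inj : injective (@emb R k).
Proof. by move=> r s /(congr1 (@re R k)); rewrite !re_emb. Qed.

Lemma conj_emb r : conj_scal (emb k r) = emb k r.
Proof. by apply: scal_ext; rewrite !scalE ?oppr0. Qed.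

Lemma conj_scalK : involutive (@conj_scal R k).
Proof. by move=> x; apply: scal_ext; rewrite !scalE ?opprK. Qed.

Lemma abs_sqr x : abs_scal x ^+ 2 = re x ^+ 2 + im x ^+ 2.
Proof.
case: k x => [x|[a b]] /=; first by rewrite real_normK ?num_real// expr0n addr0.
by rewrite sqr_sqrtr// addr_ge0 ?sqr_ge0.
Qed.

Lemma abs_ge0 x : 0 <= abs_scal x.
Proof. by case: k x => [x|[a b]] /=; rewrite ?normr_ge0 ?sqrtr_ge0. Qed.

Lemma absM x y : abs_scal (x * y) = abs_scal x * abs_scal y.
Proof. by case: k x y => [x y|x y]; [exact: normrM|exact: ComplexField.Normc.normcM]. Qed.

Lemma absD x y : abs_scal (x + y) <= abs_scal x + abs_scal y.
Proof. by case: k x y => [x y|x y]; [exact: ler_normD|exact: le_normcD]. Qed.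

Lemma absE x : abs_scal x = Num.sqrt (re x ^+ 2 + im x ^+ 2).
Proof. by rewrite -abs_sqr sqrtr_sqr ger0_norm// abs_ge0. Qed.

Lemma abs0 : abs_scal (0 : F) = 0.
Proof. by rewrite absE !raddf0 expr0n addr0 sqrtr0. Qed.

Lemma absN x : abs_scal (- x) = abs_scal x.
Proof. by rewrite !absE !raddfN !sqrrN. Qed.

Lemma abs_conj x : abs_scal (conj_scal x) = abs_scal x.
Proof. by rewrite !absE !scalE sqrrN. Qed.

Lemma abs_emb r : abs_scal (emb k r) = `|r|.
Proof. by rewrite absE !scalE expr0n addr0 sqrtr_sqr. Qed.

Lemma abs_re x : `|re x| <= abs_scal x.
Proof. by rewrite absE -sqrtr_sqr ler_wsqrtr// lerDl sqr_ge0. Qed.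

Lemma abs_im x : `|im x| <= abs_scal x.
Proof. by rewrite absE -sqrtr_sqr ler_wsqrtr// lerDr sqr_ge0. Qed.

Lemma abs_le_re_im x : abs_scal x <= `|re x| + `|im x|.
Proof.
rewrite -(ler_pXn2r (ltn0Sn 1)) ?nnegrE ?abs_ge0 ?addr_ge0//.
rewrite abs_sqr sqrrD !real_normK ?num_real// lerD2r lerDl.
by rewrite mulrn_wge0// mulr_ge0.
Qed.

Lemma abs_eq0 x : abs_scal x = 0 -> x = 0.
Proof.
move=> x0; apply: scal_ext; rewrite raddf0; apply/eqP; rewrite -normr_le0 -x0.
  exact: abs_re.
exact: abs_im.
Qed.

Lemma mul_conj x : x * conj_scal x = emb k (abs_scal x ^+ 2).
Proof. by rewrite abs_sqr; apply: scal_ext; rewrite !scalE; ring. Qed.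

Lemma abs_sum (I : finType) (f : I -> F) :
  abs_scal (\sum_i f i) <= \sum_i abs_scal (f i).
Proof.
elim/big_ind2: _ => // [|x1 x2 y1 y2 h1 h2]; first by rewrite abs0.
by rewrite (le_trans (absD _ _))// lerD.
Qed.

(** The phases are exactly the scalars of modulus one; over the complex numbers
    the argument of [c + is] is [acos c] or [2 pi - acos c], according to the
    sign of [s]. *)
Lemma phasesE (u : F) : @phases R k u <-> abs_scal u = 1.
Proof.
case: k u => [u|[a b]] /=.
  split => [[->|->]|]; rewrite ?normrN ?normr1//.
  by move/eqP; rewrite eqr_norml ler01 andbT => /orP[]/eqP; [left|right].
split => [[phi _ [<- <-]]|ab].
  by rewrite cos2Dsin2 sqrtr1.
have ab1 : a ^+ 2 + b ^+ 2 = 1.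
  by rewrite -[LHS]sqr_sqrtr ?ab ?expr1n// addr_ge0 ?sqr_ge0.
have b2 : b ^+ 2 = 1 - a ^+ 2 by rewrite -ab1; ring.
have a1 : -1 <= a <= 1.
  by have := sqr_ge0 b; rewrite b2 => h; apply/andP; split; nra.
have sb : sin (acos a) = `|b| by rewrite sin_acos// -b2 sqrtr_sqr.
have [b0|b0] := leP 0 b.
  exists (acos a); last by rewrite acosK// sb ger0_norm.
  have p0 := pi_gt0 R; have ap := acos_lepi a1.
  rewrite /= acos_ge0//=. lra.
exists (2 * pi - acos a); last first.
  have -> : 2 * pi - acos a = - acos a + pi *+ 2 by rewrite mulr_natl addrC.
  by rewrite cosD2pi sinD2pi cosN sinN acosK// sb ltr0_norm// opprK.
rewrite /= subr_ge0 gtrBl acos_gt0 ?andbT; last first.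
  case/andP: a1 => -> /= a1; rewrite lt_neqAle a1 andbT; apply/eqP => a1'.
  by move: b2; rewrite a1' expr1n subrr => /eqP; rewrite sqrf_eq0 lt_eqF.
by have p0 := pi_gt0 R; have ap := acos_lepi a1; lra.
Qed.

End Scalars.

(* Simplification must not unfold these once the scalar kind is instantiated. *)
Arguments conj_scal : simpl never.
Arguments abs_scal : simpl never.
Arguments re : simpl never.
Arguments im : simpl never.
Arguments emb : simpl never.

(** * Inner products and unitary maps *)

Lemma reflection_coefficient (F : fieldType) (r s : F) :
  1 - r != 0 -> 1 - s != 0 ->
  - (1 - s)^-1 + - (1 - r)^-1 + - (1 - s)^-1 * - (1 - r)^-1 * (2 - r - s) = 0.
Proof. by move=> r1 s1; field; rewrite r1 s1. Qed.

Section InnerProduct.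
Variables (R : realType) (k : scalar_kind) (n : nat).
Local Notation F := (scal R k).
Local Notation V := 'cV[F]_n.
Implicit Types (x y z a b v w : V) (c u : F).

Definition sumsq x : R := \sum_(j < n) abs_scal (x j ord0) ^+ 2.

Lemma innerDl x y z : inner (x + y) z = inner x z + inner y z.
Proof. by rewrite -big_split; apply: eq_bigr => j _; rewrite mxE mulrDl. Qed.

Lemma innerZl c x z : inner (c *: x) z = c * inner x z.
Proof. by rewrite mulr_sumr; apply: eq_bigr => j _; rewrite mxE mulrA. Qed.

Lemma innerNl x z : inner (- x) z = - inner x z.
Proof. by rewrite -scaleN1r innerZl mulN1r. Qed.

Lemma innerBl x y z : inner (x - y) z = inner x z - inner y z.
Proof. by rewrite innerDl innerNl. Qed.

Lemma inner_conj x z : conj_scal (inner x z) = inner z x.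
Proof.
by rewrite rmorph_sum; apply: eq_bigr => j _; rewrite rmorphM/= conj_scalK mulrC.
Qed.

Lemma innerDr x y z : inner z (x + y) = inner z x + inner z y.
Proof. by rewrite -!(inner_conj _ z) innerDl rmorphD. Qed.

Lemma innerZr c x z : inner z (c *: x) = conj_scal c * inner z x.
Proof. by rewrite -!(inner_conj _ z) innerZl rmorphM. Qed.

Lemma innerBr x y z : inner z (x - y) = inner z x - inner z y.
Proof. by rewrite -!(inner_conj _ z) innerBl rmorphB. Qed.

Lemma inner_self x : inner x x = emb k (sumsq x).
Proof.
apply: scal_ext; rewrite !scalE !raddf_sum /=.
  by apply: eq_bigr => j _; rewrite mul_conj re_emb.
by rewrite big1// => j _; rewrite mul_conj im_emb.
Qed.

Lemma sumsq_ge0 x : 0 <= sumsq x.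
Proof. by apply: sumr_ge0 => j _; rewrite sqr_ge0. Qed.

Lemma sumsq_eq0 x : sumsq x = 0 -> x = 0.
Proof.
move=> /eqP; rewrite psumr_eq0 => [/allP h|j _]; last exact: sqr_ge0.
apply/matrixP => i j; rewrite ord1 mxE; apply: abs_eq0; apply/eqP.
by rewrite -sqrf_eq0; apply: h; rewrite mem_index_enum.
Qed.

Lemma sumsqZ (r : R) x : sumsq (emb k r *: x) = r ^+ 2 * sumsq x.
Proof.
rewrite mulr_sumr; apply: eq_bigr => j _.
by rewrite mxE absM abs_emb exprMn real_normK ?num_real.
Qed.

Lemma unit_sphere_inner x : @unit_sphere R k n x -> inner x x = 1.
Proof. by rewrite inner_self /unit_sphere/= /sumsq => ->; rewrite emb1. Qed.

Lemma normalize x : x != 0 ->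
  exists2 r : R, 0 < r & @unit_sphere R k n (emb k r *: x).
Proof.
move=> x0; have s0 : 0 < sumsq x.
  rewrite lt_neqAle sumsq_ge0 andbT eq_sym.
  by apply: contraNneq x0 => /sumsq_eq0 ->.
exists (Num.sqrt (sumsq x))^-1; first by rewrite invr_gt0 sqrtr_gt0.
rewrite /unit_sphere /= -/(sumsq _) sumsqZ exprVn sqr_sqrtr ?ltW//.
by rewrite mulVf// gt_eqF.
Qed.

Lemma unit_sphere_le1 z j : @unit_sphere R k n z -> abs_scal (z j ord0) <= 1.
Proof.
move=> z1; rewrite -(ler_pXn2r (ltn0Sn 1)) ?nnegrE ?abs_ge0// expr1n -z1.
by rewrite (bigD1 j)//= lerDl sumr_ge0// => i _; rewrite sqr_ge0.
Qed.

Lemma abs_inner_le x z : @unit_sphere R k n z ->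
  abs_scal (inner x z) <= \sum_(j < n) abs_scal (x j ord0).
Proof.
move=> z1; rewrite (le_trans (abs_sum _))// ler_sum// => j _.
by rewrite absM abs_conj ler_piMr ?abs_ge0 ?unit_sphere_le1.
Qed.

Lemma abs_inner_unit_le x z : @unit_sphere R k n x -> @unit_sphere R k n z ->
  abs_scal (inner x z) <= n%:R.
Proof.
move=> x1 z1; rewrite (le_trans (abs_inner_le _ z1))//.
rewrite -[n in leRHS]card_ord -sum1_card natr_sum ler_sum// => j _.
exact: unit_sphere_le1.
Qed.

(** The update [1 + c w w^*] covers the two kinds of unitary maps needed below: the map
    taking one unit vector to another, and the change of phase along a line. *)
Definition rank_one_update c w : 'M[F]_n :=
  1%:M + c *: (w *m (map_mx (@conj_scal R k) w)^T).

Lemma rank_one_update_unitary c w :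
  c + conj_scal c + c * conj_scal c * inner w w = 0 ->
  unitary (rank_one_update c w).
Proof.
move=> cw; rewrite /unitary /rank_one_update.
set wa := (map_mx _ w)^T.
have -> : (map_mx (@conj_scal R k) (1%:M + c *: (w *m wa)))^T =
    1%:M + conj_scal c *: (w *m wa).
  rewrite map_mxD map_mx1 map_mxZ map_mxM linearD linearZ /= trmx1 trmx_mul.
  congr (_ + _ *: (_ *m _)); rewrite /wa.
  by apply/matrixP => i j; rewrite !mxE conj_scalK.
have ww : wa *m w = (inner w w)%:M.
  apply/matrixP => i j; rewrite !ord1 !mxE /inner mulr1n.
  by apply: eq_bigr => l _; rewrite !mxE mulrC.
rewrite mulmxDl mul1mx mulmxDr mulmx1 -!scalemxAl -!scalemxAr.
rewrite mulmxA -(mulmxA w) ww mul_mx_scalar -scalemxAl !scalerA.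
rewrite -[RHS]addr0 -addrA; congr (_ + _).
by rewrite -!scalerDl -(scale0r (w *m wa)) -cw; congr (_ *: _); ring.
Qed.

Lemma inner_rank_one_update c w x z :
  inner x (rank_one_update c w *m z) =
  inner x z + conj_scal c * inner x w * inner w z.
Proof.
rewrite mulmxDl mul1mx innerDr; congr (_ + _).
have -> : c *: (w *m (map_mx (@conj_scal R k) w)^T) *m z = (c * inner z w) *: w.
  rewrite -scalemxAl -mulmxA -scalerA; congr (_ *: _).
  apply/matrixP => i j; rewrite !ord1 !mxE big_ord1 mulrC; congr (_ * _).
  by rewrite !mxE; apply: eq_bigr => l _; rewrite !mxE mulrC.
by rewrite innerZr rmorphM/= inner_conj; ring.
Qed.

(** A reflection along [a - v], whose phase is tuned to [<a, v>]: with
    [rho = <a, v>] one has [|a - v|^2 = 2 - rho - conj rho], and the coefficient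
    [- (1 - conj rho)^-1] is the one for which the rank-one update both is unitary
    and moves [v] to [a]. *)
Lemma unitary_transport a v :
  @unit_sphere R k n a -> @unit_sphere R k n v ->
  exists2 U : 'M[F]_n, unitary U & forall z, inner a (U *m z) = inner v z.
Proof.
move=> /unit_sphere_inner a1 /unit_sphere_inner v1.
have [->|av] := eqVneq a v.
  exists (rank_one_update 0 v) => [|z].
    by apply: rank_one_update_unitary; rewrite rmorph0 !mul0r !addr0.
  by rewrite inner_rank_one_update rmorph0 !mul0r addr0.
pose rho := inner a v.
have rhoc : conj_scal rho = inner v a by rewrite inner_conj.
have ww : inner (a - v) (a - v) = 2 - rho - conj_scal rho.
  by rewrite innerBl !innerBr a1 v1 rhoc /rho; ring.
have rho1 : 1 - rho != 0.
  apply: contraNneq av => /eqP; rewrite subr_eq0 => /eqP r1.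
  rewrite -subr_eq0; apply/eqP/sumsq_eq0/(@emb_inj R k).
  by rewrite -inner_self ww -r1 rmorph1 emb0; ring.
have rho1' : 1 - conj_scal rho != 0.
  by rewrite -(rmorph1 (@conj_scal R k)) -rmorphB fmorph_eq0.
pose c := - (1 - conj_scal rho)^-1.
have cc : conj_scal c = - (1 - rho)^-1.
  by rewrite rmorphN fmorphV rmorphB rmorph1/= conj_scalK.
exists (rank_one_update c (a - v)) => [|z].
  apply: rank_one_update_unitary; rewrite ww cc /c.
  exact: reflection_coefficient.
rewrite inner_rank_one_update cc innerBr a1 -/rho innerBl.
have -> : - (1 - rho)^-1 * (1 - rho) = -1.
  by rewrite mulNr mulVf.
by ring.
Qed.

(** * Reduction to a bilinear separation property *)

(** Polarization turns [|<x, z>|^2 - |<y, z>|^2] into [cross (x - y) (x + y) z]. *)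
Definition cross a b z : R := re (inner a z * conj_scal (inner b z)).

(** Scaling [a] and [b] to the sphere makes this a statement about a compact set
    of pairs; keeping [<a, b>] real bounds the Hermitian form [cross a b] away
    from zero, whereas it vanishes identically when [b = i a]. *)
Definition separating (I : Type) (z : I -> V) : Prop :=
  forall a b, @unit_sphere R k n a -> @unit_sphere R k n b ->
  im (inner a b) = 0 -> exists i, cross a b (z i) != 0.

Lemma cross_polarization x y z :
  cross (x - y) (x + y) z = abs_scal (inner x z) ^+ 2 - abs_scal (inner y z) ^+ 2.
Proof. by rewrite /cross innerBl innerDl !abs_sqr !scalE; ring. Qed.

Lemma abs_cross a b z :
  `|cross a b z| <= abs_scal (inner a z) * abs_scal (inner b z).
Proof. by rewrite (le_trans (abs_re _))// absM abs_conj. Qed.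

(** Rotating [x] so that [<x, x0>] becomes real makes [<x - x0, x + x0>] real,
    and separation forces one of [x - x0], [x + x0] to vanish. *)
Lemma separating_recovery m (z : 'I_m -> V) x0 : separating z ->
  [set x | phaseless_map z x = phaseless_map z x0] =
  [set u *: x0 | u in @phases R k].
Proof.
move=> sep; apply/seteqP; split=> [x /= xx0|_ [u /phasesE u1 <-]/=]; last first.
  by apply/matrixP => i j; rewrite !mxE innerZl absM u1 mul1r.
have [w w1 wx] : exists2 w : F, abs_scal w = 1 & im (inner (w *: x) x0) = 0.
  have [p0|p0] := eqVneq (inner x x0) 0.
    exists 1; first by rewrite -emb1 abs_emb normr1.
    by rewrite scale1r p0 raddf0.
  have a0 : abs_scal (inner x x0) != 0.
    by apply: contraNneq p0 => /abs_eq0 ->.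
  exists (emb k (abs_scal (inner x x0))^-1 * conj_scal (inner x x0)).
    by rewrite absM abs_conj abs_emb ger0_norm ?invr_ge0 ?abs_ge0// mulVf.
  by rewrite innerZl -mulrA [conj_scal _ * _]mulrC mul_conj -embM im_emb.
have wV : conj_scal w * w = 1 by rewrite mulrC mul_conj w1 expr1n emb1.
pose a := w *: x - x0; pose b := w *: x + x0.
have ab0 i : cross a b (z i) = 0.
  rewrite cross_polarization innerZl absM w1 mul1r.
  by move/matrixP/(_ i ord0) : xx0; rewrite !mxE => ->; rewrite subrr.
have imab : im (inner a b) = 0.
  rewrite innerBl !innerDr !inner_self -[inner x0 (w *: x)]inner_conj.
  by rewrite !scalE wx; ring.
have scal_phase u : abs_scal u = 1 -> w *: x = u *: x0 ->
    [set u *: x0 | u in @phases R k] x.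
  move=> u1 xu; exists (conj_scal w * u).
    by apply/phasesE; rewrite absM abs_conj u1 w1 mulr1.
  by rewrite -scalerA -xu scalerA wV scale1r.
have [a0|a0] := eqVneq a 0.
  apply: (scal_phase 1); first by rewrite -emb1 abs_emb normr1.
  by rewrite scale1r; apply/eqP; rewrite -subr_eq0 -/a a0.
have [b0|b0] := eqVneq b 0.
  apply: (scal_phase (-1)); first by rewrite absN -emb1 abs_emb normr1.
  by rewrite scaleN1r; apply/eqP; rewrite -addr_eq0 -/b b0.
have [r r0 ra] := normalize a0; have [s s0 sb] := normalize b0.
have [|i] := sep _ _ ra sb.
  by rewrite innerZl innerZr conj_emb !scalE imab; ring.
case/negP; apply/eqP; move: (ab0 i); rewrite /cross !innerZl rmorphM/= conj_emb.
move: (inner a (z i)) (inner b (z i)) => p q pq.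
have -> : emb k r * p * (emb k s * conj_scal q) =
  emb k (r * s) * (p * conj_scal q) by rewrite embM; ring.
by rewrite reM re_emb im_emb pq; ring.
Qed.

End InnerProduct.

(** * Measurability and counting *)

Section RealContinuous.
Variables (R : realType) (T : topologicalType).

Lemma continuous_muladd (f g h l : T -> R) :
  continuous f -> continuous g -> continuous h -> continuous l ->
  continuous (fun x => f x * g x + h x * l x).
Proof.
move=> fc gc hc lc x; apply: cvgD; apply: cvgM;
  by [exact: fc|exact: gc|exact: hc|exact: lc].
Qed.

Lemma continuous_fsum (I : finType) (f : I -> T -> R) :
  (forall i, continuous (f i)) -> continuous (fun z => \sum_i f i z).
Proof.
move=> fc z; elim: (index_enum I) => [|i s ih].
  rewrite (_ : (fun _ => _) = cst 0); first exact: cst_continuous.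
  by apply/funext => x; rewrite big_nil.
rewrite (_ : (fun _ => _) = (fun x => f i x + \sum_(j <- s) f j x)).
  by apply: continuousD => //; exact: fc.
by apply/funext => x; rewrite big_cons.
Qed.

Lemma continuous_abs (f : T -> R) :
  continuous f -> continuous (fun x => `|f x|).
Proof. by move=> fc x; apply: cvg_norm; exact: fc. Qed.

End RealContinuous.

Section Borel.
Variables (R : realType) (k : scalar_kind).
Local Notation F := (scal R k).

Lemma lipschitz_scal_continuous (f : F -> R) :
  (forall x y, `|f x - f y| <= abs_scal (x - y)) -> continuous f.
Proof.
move=> fl x; apply: (@cvgrPdist_lt _ _ _ _ (nbhs_filter x) f (f x)).2 => e e0.
suff [d d0 dP] : exists2 d : F, 0 < d &
    forall y : F, ball x d y -> abs_scal (x - y) < e.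
  apply/nbhs_ballP; exists d => // y xy /=.
  by rewrite (le_lt_trans (fl _ _))// dP.
case: k x {f fl} => x; first by exists e.
exists (real_complex R e) => [|y]; first by rewrite ltcR.
by rewrite /ball /= -ltcR.
Qed.

Lemma re_continuous : continuous (@re R k).
Proof. by apply: lipschitz_scal_continuous => x y; rewrite -raddfB abs_re. Qed.

Lemma im_continuous : continuous (@im R k).
Proof. by apply: lipschitz_scal_continuous => x y; rewrite -raddfB abs_im. Qed.

Variable n : nat.
Local Notation V := 'cV[F]_n.

Lemma re_coord_continuous j : continuous (fun z : V => re (z j ord0)).
Proof.
move=> z; apply: (@continuous_comp _ _ _ (fun z : V => z j ord0)).
  exact: coord_continuous.
exact: re_continuous.
Qed.

Lemma im_coord_continuous j : continuous (fun z : V => im (z j ord0)).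
Proof.
move=> z; apply: (@continuous_comp _ _ _ (fun z : V => z j ord0)).
  exact: coord_continuous.
exact: im_continuous.
Qed.

Lemma re_inner_continuous (a : V) : continuous (fun z => re (inner a z)).
Proof.
rewrite (_ : (fun _ => _) = (fun z : V => \sum_j
   (re (a j ord0) * re (z j ord0) + im (a j ord0) * im (z j ord0)))).
  apply: continuous_fsum => j; apply: continuous_muladd;
    by [move=> z; exact: cst_continuous|exact: re_coord_continuous|exact: im_coord_continuous].
by apply/funext => z; rewrite raddf_sum; apply: eq_bigr => j _ /=; rewrite !scalE; ring.
Qed.

Lemma im_inner_continuous (a : V) : continuous (fun z => im (inner a z)).
Proof.
rewrite (_ : (fun _ => _) = (fun z : V => \sum_j
   (im (a j ord0) * re (z j ord0) + - re (a j ord0) * im (z j ord0)))).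
  apply: continuous_fsum => j; apply: continuous_muladd;
    by [move=> z; exact: cst_continuous|exact: re_coord_continuous|exact: im_coord_continuous].
by apply/funext => z; rewrite raddf_sum; apply: eq_bigr => j _ /=; rewrite !scalE; ring.
Qed.

Lemma measurable_closed (A : set (borel_vec R k n)) :
  closed (A : set V) -> measurable A.
Proof.
move=> cA; rewrite -[A]setCK; apply: measurableC.
by apply: sub_sigma_algebra; exact: closed_openC.
Qed.

Lemma measurable_le (f : V -> R) (e : R) : continuous f ->
  measurable ([set z | f z <= e] : set (borel_vec R k n)).
Proof.
move=> fc; apply: measurable_closed.
by apply: (@closed_comp _ _ f [set r | r <= e]) => [z _|]; [exact: fc|exact: closed_le].
Qed.

Lemma measurable_slab (a : V) (e : R) : 0 <= e ->
  measurable ([set z | abs_scal (inner a z) <= e] : set (borel_vec R k n)).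
Proof.
move=> e0; rewrite (_ : [set _ | _] =
    [set z | re (inner a z) ^+ 2 + im (inner a z) ^+ 2 <= e ^+ 2]).
  apply: measurable_le; apply: continuous_muladd;
    by [exact: re_inner_continuous|exact: im_inner_continuous].
by apply/seteqP; split=> z /=; rewrite -abs_sqr ler_pXn2r// nnegrE abs_ge0.
Qed.

Lemma measurable_cross (a b : V) (e : R) :
  measurable ([set z | `|cross a b z| <= e] : set (borel_vec R k n)).
Proof.
rewrite (_ : [set _ | _] = [set z | `|re (inner a z) * re (inner b z) +
    im (inner a z) * im (inner b z)| <= e]); last first.
  by apply/seteqP; split=> z /=; rewrite /cross !scalE mulrN opprK.
apply: measurable_le; apply: continuous_abs.
apply: continuous_muladd;
  by [exact: re_inner_continuous|exact: im_inner_continuous].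
Qed.

Lemma measurable_unit_sphere :
  measurable (@unit_sphere R k n : set (borel_vec R k n)).
Proof.
have cf : continuous (fun z : V => sumsq z).
  rewrite (_ : (fun _ => _) = (fun z : V => \sum_j
     (re (z j ord0) ^+ 2 + im (z j ord0) ^+ 2))).
    apply: continuous_fsum => j; apply: continuous_muladd;
      by [exact: re_coord_continuous|exact: im_coord_continuous].
  by apply/funext => z; apply: eq_bigr => j _; rewrite abs_sqr.
apply: measurable_closed.
apply: (@closed_comp _ _ (fun z : V => sumsq z) [set r | r = 1]) => [z _|].
  exact: cf.
exact: closed_eq.
Qed.

End Borel.

Section Counting.
Variables (d : measure_display) (T : measurableType d) (R : realType).
Variable mu : probability T R.
Local Open Scope ereal_scope.

Lemma union_bound (I : finType) (B : I -> set T) :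
  (forall i, measurable (B i)) ->
  mu (\big[setU/set0]_i B i) <= \sum_i mu (B i).
Proof.
move=> mB; elim: (index_enum I) => [|i s ih]; first by rewrite !big_nil measure0.
rewrite !big_cons (le_trans (measureU2 _ _ _))//; first exact: bigsetU_measurable.
by rewrite leeD2l.
Qed.

(** Invariance gives many events of equal mass; this is how a bound on their
    overlaps turns into a bound on that mass. *)
Lemma double_counting (I : finType) (B : I -> set T) (S : set T) (K : nat) :
  (forall i, measurable (B i)) -> measurable S -> mu S = 1 ->
  (forall z, S z -> (#|[pred i | `[< B i z >]]| <= K)%N) ->
  \sum_i mu (B i) <= K%:R%:E.
Proof.
move=> mB mS S1 BK.
have SC0 : mu (~` S) = 0 by rewrite probability_setC// S1 subee.
have muS i : mu (B i) = mu (B i `&` S).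
  apply/eqP; rewrite eq_le; apply/andP; split; last first.
    by apply: le_measure; rewrite ?inE//; exact: measurableI.
  rewrite -[leRHS]adde0 -SC0 (le_trans _ (measureU2 _ _ _))//.
  - apply: le_measure; rewrite ?inE//.
      by apply: measurableU; [exact: measurableI|exact: measurableC].
    by move=> z Bz; have [Sz|Sz] := pselect (S z); [left|right].
  - exact: measurableI.
  - exact: measurableC.
under eq_bigr do rewrite muS.
have -> : \sum_i mu (B i `&` S) =
    \int[mu]_z (\sum_i (\1_(B i `&` S) z)%:E).
  rewrite ge0_integral_sum//=.
  - apply: eq_bigr => i _; rewrite integral_indic ?setIT//.
    exact: measurableI.
  - move=> i; apply/measurable_EFinP; apply: measurable_indic.
    exact: measurableI.
have -> : K%:R%:E = \int[mu]_z (cst K%:R%:E z).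
  by rewrite integral_cst//= probability_setT mule1.
apply: ge0_le_integral => //.
- by move=> z _; apply: sume_ge0 => i _; rewrite lee_fin.
- apply: emeasurable_sum => i; apply/measurable_EFinP; apply: measurable_indic.
  exact: measurableI.
- move=> z _; rewrite sumEFin lee_fin.
have [Sz|Sz] := pselect (S z); last first.
  by rewrite big1// => i _; rewrite indicE memNset//= => -[].
rewrite (le_trans _ (_ : #|[pred i | `[< B i z >]]|%:R <= _)%R)//; last first.
  by rewrite ler_nat BK.
rewrite -sum1_card natr_sum [leRHS]big_mkcond ler_sum// => i _.
rewrite indicE in_setI (mem_set Sz) andbT unfold_in /=.
by case: asboolP => [Bz|nBz]; [rewrite mem_set|rewrite memNset].
Qed.

End Counting.

(** * Small-ball estimates from invariance *)

Lemma natr_dist_ge1 (R : realType) (i j : nat) :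
  i != j -> 1 <= `|i%:R - j%:R : R|.
Proof.
by move=> ij; rewrite !pmulrn -intrB -intr_norm (ler_int _ 1) -gtz0_ge1
  normr_gt0 subr_eq0.
Qed.

Section SmallBall.
Variables (R : realType) (k : scalar_kind).
Local Notation F := (scal R k).

(** The property of a law that makes a random vector [uniform_on_sphere]. *)
Definition rotation_invariant (n : nat) (mu : set (borel_vec R k n) -> \bar R) :=
  mu (@unit_sphere R k n) = 1%E /\
  forall (U : 'M[F]_n) (B : set (borel_vec R k n)),
    unitary U -> measurable B -> mu [set z | B (U *m z)] = mu B.

Definition grid (n M : nat) (g : {ffun 'I_n -> 'I_M}) : 'cV[F]_n :=
  \col_j emb k (g j).+1%:R.

Lemma sumsq_grid_le n M (g : {ffun 'I_n -> 'I_M}) :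
  sumsq (grid g) <= (n%:R * M%:R) ^+ 2.
Proof.
have h : sumsq (grid g) <= \sum_(j < n) M%:R ^+ 2.
  apply: ler_sum => j _; rewrite mxE abs_emb ler_pXn2r ?nnegrE//.
  by rewrite ger0_norm// ler_nat.
rewrite (le_trans h)// sumr_const card_ord exprMn -[leLHS]mulr_natl.
by rewrite ler_wpM2r ?sqr_ge0// -natrX ler_nat; case: (n) => // p; rewrite leq_pmulr.
Qed.

Lemma grid_neq0 n M (g : {ffun 'I_n.+1 -> 'I_M}) : grid g != 0.
Proof.
apply: contraTneq isT => /matrixP/(_ ord0 ord0); rewrite !mxE -(emb0 R k).
by move/emb_inj/eqP; rewrite pnatr_eq0.
Qed.

Lemma unit_sphere_big_coord n (z : 'cV[F]_n.+1) : @unit_sphere R k n.+1 z ->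
  exists j, n.+1%:R^-1 <= abs_scal (z j ord0).
Proof.
move=> z1; apply: contrapT => /forallNP small.
have : \sum_(j < n.+1) abs_scal (z j ord0) ^+ 2 < \sum_(j < n.+1) n.+1%:R^-1.
  apply: ltr_sum => [|j _]; first by apply/hasP; exists ord0; rewrite ?mem_index_enum.
  rewrite (@le_lt_trans _ _ (abs_scal (z j ord0)))//; last first.
    by rewrite ltNge; apply/negP/small.
  by rewrite expr2 ler_piMr ?abs_ge0 ?unit_sphere_le1.
rewrite z1 sumr_const card_ord -[_ *+ _]mulr_natl divff ?ltxx//.
Qed.

(** Two grid vectors in a common narrow slab, differing in a single coordinate
    [j] where [z] is large, coincide; so a slab meets each grid line in the
    direction [j] at most once. *)
Lemma card_grid_slab n M (z : 'cV[F]_n.+1) : @unit_sphere R k n.+1 z ->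
  (#|[pred g : {ffun 'I_n.+1 -> 'I_M} |
      `[< (abs_scal (inner (grid g) z) <= (4 * n.+1%:R)^-1)%R >]]| <= M ^ n)%N.
Proof.
move=> z1; have [j zj] := unit_sphere_big_coord z1.
pose f (g : {ffun 'I_n.+1 -> 'I_M}) : {ffun 'I_n -> 'I_M} := [ffun i => g (lift j i)].
set D := [pred g | _].
suff fI : {in D &, injective f}.
  by rewrite -(card_in_image fI) (leq_trans (max_card _))// card_ffun !card_ord.
move=> g h /asboolP gz /asboolP hz fgh.
have off i : i != j -> g i = h i.
  case: (unliftP j i) => [i' ->|->]; last by rewrite eqxx.
  by move=> _; move/ffunP/(_ i') : fgh; rewrite !ffunE.
suff gj : g j = h j.
  by apply/ffunP => i; have [->|/off] := eqVneq i j.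
have : abs_scal (inner (grid g - grid h) z) <= (2 * n.+1%:R)^-1.
  rewrite innerBl (le_trans (absD _ _))// absN (le_trans (lerD gz hz))//.
  by rewrite !invfM; move: (n.+1%:R^-1) => x; lra.
rewrite /inner (bigD1 j)//= big1 ?addr0 => [|i /off gh]; last first.
  by rewrite !mxE gh subrr mul0r.
rewrite absM abs_conj !mxE.
have -> : emb k (g j).+1%:R - emb k (h j).+1%:R = emb k ((g j)%:R - (h j)%:R :> R).
  by apply: scal_ext; rewrite !scalE -?natr1 -?[in (h j).+1%:R]natr1; ring.
rewrite abs_emb => small; apply/val_inj/eqP; apply: contraT => neq.
have d1 := @natr_dist_ge1 R _ _ neq.
have n0 : 0 < n.+1%:R^-1 :> R by rewrite invr_gt0.
have := ler_peMl (abs_ge0 (z j ord0)) d1; move: small n0 zj; rewrite invfM.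
by move: (n.+1%:R^-1) => x; lra.
Qed.

Section Slab.
Variables (n M : nat) (mu : probability (borel_vec R k n.+1) R).
Hypotheses (M0 : (0 < M)%N) (mu_inv : rotation_invariant mu).

(** By invariance the slab has the same mass around each normalized grid vector,
    and few of these slabs overlap. *)
Lemma slab_small (a : 'cV[F]_n.+1) : @unit_sphere R k n.+1 a ->
  (mu [set z | (abs_scal (inner a z) <= (4 * n.+1%:R ^+ 2 * M%:R)^-1)%R] <=
   (M%:R^-1)%:E)%E.
Proof.
move=> a1; set e := (4 * _ * _)^-1; set A := [set z | _].
have e0 : 0 <= e by rewrite invr_ge0.
have /choice[r rP] : forall g : {ffun 'I_n.+1 -> 'I_M},
    exists s : R, 0 < s /\ @unit_sphere R k n.+1 (emb k s *: grid g).
  by move=> g; have [s s0 s1] := normalize (grid_neq0 g); exists s.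
pose B g : set (borel_vec R k n.+1) :=
  [set z | abs_scal (inner (emb k (r g) *: grid g) z) <= e].
have mA : measurable (A : set (borel_vec R k n.+1)) by exact: measurable_slab.
have mB g : measurable (B g) by exact: measurable_slab.
have muB g : mu (B g) = mu A.
  have [U Uu Ua] := unitary_transport a1 (rP g).2.
  rewrite -[RHS](mu_inv.2 U)//; congr (mu _); apply/seteqP.
  by split=> z; rewrite /A /B /= Ua.
have Bgrid g z : B g z -> abs_scal (inner (grid g) z) <= (4 * n.+1%:R)^-1.
  have [r0 r1] := rP g; rewrite /B /= innerZl absM abs_emb gtr0_norm// => Bz.
  have r1' : 1 <= r g * (n.+1%:R * M%:R).
    rewrite -(ler_pXn2r (ltn0Sn 1)) ?nnegrE//; last by rewrite mulr_ge0// ltW.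
    rewrite expr1n exprMn -[leLHS]r1 -/(sumsq _) sumsqZ ler_wpM2l ?sqr_ge0//.
    exact: sumsq_grid_le.
  have -> : (4 * n.+1%:R)^-1 = e * (n.+1%:R * M%:R) :> R.
    have M0' : M%:R != 0 :> R by rewrite pnatr_eq0 -lt0n.
    have n0 : n.+1%:R != 0 :> R by rewrite pnatr_eq0.
    by rewrite /e; move: (M%:R) (n.+1%:R) M0' n0 => x y x0 y0; field; rewrite x0 y0.
  have nM0 : 0 < n.+1%:R * M%:R :> R by rewrite mulr_gt0 ?ltr0n.
  have := abs_ge0 (inner (grid g) z) => i0.
  rewrite (@le_trans _ _ (r g * (n.+1%:R * M%:R) * abs_scal (inner (grid g) z)))//.
    by rewrite ler_peMl.
  by rewrite mulrAC ler_wpM2r// ltW.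
have [p Ap] : exists p, mu A = p%:E.
  by exists (fine (mu A)); rewrite fineK// fin_num_measure.
have : (\sum_g mu (B g) <= (M ^ n)%:R%:E)%E.
  have mS : measurable (@unit_sphere R k n.+1 : set (borel_vec R k n.+1)).
    exact: measurable_unit_sphere.
  apply: (double_counting mB mS mu_inv.1) => z z1.
  apply: leq_trans (card_grid_slab M z1); apply/subset_leq_card/fintype.subsetP.
  by move=> g /asboolP Bz; apply/asboolP; exact: Bgrid Bz.
rewrite (eq_bigr (fun=> p%:E)) => [|g _]; last by rewrite muB.
rewrite sumEFin sumr_const card_ffun !card_ord Ap !lee_fin -[leLHS]mulr_natr !natrX.
have M0' : 0 < M%:R :> R by rewrite ltr0n.
rewrite exprS mulrA -[leRHS]mul1r ler_pM2r ?exprn_gt0// => pM.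
by rewrite -[leRHS]mul1r ler_pdivlMr.
Qed.

End Slab.

End SmallBall.

(** * Rational rotations and quadratic interpolation *)

(** Divided differences: dividing by the gaps, which are at least one, does not
    increase the errors. *)
Lemma quadratic_coef_le (R : realType) (p0 p1 p2 x y w N eta : R) :
  1 <= `|x - y| -> 1 <= `|x - w| -> 1 <= `|y - w| ->
  0 <= x <= N -> 0 <= y <= N -> 0 <= w <= N -> 1 <= N ->
  `|p0 + p1 * x + p2 * x ^+ 2| <= eta ->
  `|p0 + p1 * y + p2 * y ^+ 2| <= eta ->
  `|p0 + p1 * w + p2 * w ^+ 2| <= eta ->
  [/\ `|p0| <= 15 * eta * N ^+ 2, `|p1| <= 15 * eta * N ^+ 2 &
      `|p2| <= 15 * eta * N ^+ 2].
Proof.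
move=> xy xw yw xN yN wN N1 hx hy hw.
have div1 (u D c : R) : 1 <= `|u| -> `|u * D| <= c -> `|D| <= c.
  by move=> u1; apply: le_trans; rewrite normrM ler_peMl.
have D1 : `|p1 + p2 * (x + y)| <= 2 * eta.
  apply: (div1 (x - y)) => //.
  have -> : (x - y) * (p1 + p2 * (x + y)) =
    (p0 + p1 * x + p2 * x ^+ 2) - (p0 + p1 * y + p2 * y ^+ 2) by ring.
  by rewrite (le_trans (ler_normB _ _))//; lra.
have D2 : `|p1 + p2 * (x + w)| <= 2 * eta.
  apply: (div1 (x - w)) => //.
  have -> : (x - w) * (p1 + p2 * (x + w)) =
    (p0 + p1 * x + p2 * x ^+ 2) - (p0 + p1 * w + p2 * w ^+ 2) by ring.
  by rewrite (le_trans (ler_normB _ _))//; lra.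
have e0 : 0 <= eta by exact: le_trans hx.
have P2 : `|p2| <= 4 * eta.
  apply: (div1 (y - w)) => //.
  have -> : (y - w) * p2 = (p1 + p2 * (x + y)) - (p1 + p2 * (x + w)) by ring.
  by rewrite (le_trans (ler_normB _ _))//; lra.
have eN : eta <= eta * N by rewrite ler_peMr.
have eN2 : eta * N <= eta * N ^+ 2 by rewrite expr2 mulrA ler_peMr// mulr_ge0//; lra.
have P1 : `|p1| <= 10 * eta * N.
  have -> : p1 = (p1 + p2 * (x + y)) - p2 * (x + y) by ring.
  rewrite (le_trans (ler_normB _ _))// normrM [`|x + y|]ger0_norm; last lra.
  have : `|p2| * (x + y) <= (4 * eta) * (2 * N) by apply: ler_pM => //; lra.
  lra.
split; [|lra|lra].
have -> : p0 = (p0 + p1 * x + p2 * x ^+ 2) - (p1 + p2 * x) * x by ring.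
rewrite (le_trans (ler_normB _ _))// normrM [`|x|]ger0_norm; last lra.
have h1 : `|p1 + p2 * x| <= 14 * eta * N.
  rewrite (le_trans (ler_normD _ _))// normrM [`|x|]ger0_norm; last lra.
  have : `|p2| * x <= (4 * eta) * N by apply: ler_pM => //; lra.
  lra.
have : `|p1 + p2 * x| * x <= (14 * eta * N) * N by apply: ler_pM => //; lra.
rewrite -mulrA -expr2; lra.
Qed.

(** The rational parametrization of the unit circle: [|A + Re (u X)|] at the point
    of parameter [t] becomes a quadratic polynomial in [t] once the denominator
    [1 + t^2] is cleared. *)
Lemma circle_interpolation (R : realType) (A X1 X2 e M : R) (f : R -> R) (x y w : R) :
  (forall t, (1 + t ^+ 2) * f t =
     A * (1 + t ^+ 2) + X1 * (1 - t ^+ 2) - X2 * (2 * t)) ->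
  1 <= `|x - y| -> 1 <= `|x - w| -> 1 <= `|y - w| ->
  0 <= x <= M -> 0 <= y <= M -> 0 <= w <= M -> 1 <= M ->
  `|f x| <= e -> `|f y| <= e -> `|f w| <= e ->
  `|A| + `|X1| + `|X2| <= 75 * e * M ^+ 4.
Proof.
move=> fE xy xw yw xM yM wM M1 fx fy fw.
have e0 : 0 <= e by exact: le_trans fx.
have bound t : 0 <= t <= M -> `|f t| <= e ->
    `|(A + X1) + (- (2 * X2)) * t + (A - X1) * t ^+ 2| <= 2 * e * M ^+ 2.
  move=> /andP[t0 tM] ft.
  have -> : (A + X1) + (- (2 * X2)) * t + (A - X1) * t ^+ 2 = (1 + t ^+ 2) * f t.
    by rewrite fE; ring.
  have t1 : 0 <= 1 + t ^+ 2 by rewrite addr_ge0// sqr_ge0.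
  have tM2 : 1 + t ^+ 2 <= 2 * M ^+ 2.
    have : t ^+ 2 <= M ^+ 2 by rewrite ler_pXn2r// nnegrE//; lra.
    have : 1 <= M ^+ 2 by rewrite exprn_ege1.
    by lra.
  rewrite normrM (ger0_norm t1) [leRHS]mulrAC.
  by apply: ler_pM.
have [P0 P1 P2] := quadratic_coef_le xy xw yw xM yM wM M1
  (bound x xM fx) (bound y yM fy) (bound w wM fw).
have E : 15 * (2 * e * M ^+ 2) * M ^+ 2 = 30 * (e * M ^+ 4) by ring.
rewrite E in P0 P1 P2.
have -> : 75 * e * M ^+ 4 = 75 * (e * M ^+ 4) by ring.
move: P0 P1 P2; rewrite !ler_norml => /andP[? ?] /andP[? ?] /andP[? ?].
have hA : `|A| <= 30 * (e * M ^+ 4) by rewrite ler_norml; apply/andP; split; lra.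
have hX : `|X1| <= 30 * (e * M ^+ 4) by rewrite ler_norml; apply/andP; split; lra.
have hY : `|X2| <= 15 * (e * M ^+ 4) by rewrite ler_norml; apply/andP; split; lra.
by lra.
Qed.

Section CrossSmall.
Variables (R : realType) (k : scalar_kind) (n M : nat).
Variable mu : probability (borel_vec R k n.+1) R.
Hypotheses (M0 : (0 < M)%N) (mu_inv : rotation_invariant mu).

(** At radius [slab_radius], [card_grid_slab] applies to grid vectors of length up
    to [n M]. *)
Definition slab_radius : R := (4 * n.+1%:R ^+ 2 * M%:R)^-1.

(** The constant makes [75 * cross_radius * M ^ 4 < slab_radius ^ 2], where 75 and
    the power of [M] are the losses of [circle_interpolation]. *)
Definition cross_radius : R := (2000 * n.+1%:R ^+ 4 * M%:R ^+ 6)^-1.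

Lemma cross_radius_slab : 75 * cross_radius * M%:R ^+ 4 < slab_radius ^+ 2.
Proof.
have M0' : 0 < M%:R :> R by rewrite ltr0n.
have n0 : 0 < n.+1%:R :> R by rewrite ltr0n.
rewrite /cross_radius /slab_radius; move: (M%:R) (n.+1%:R) M0' n0 => m p m0 p0.
have -> : 75 * (2000 * p ^+ 4 * m ^+ 6)^-1 * m ^+ 4 = 75 / 2000 * (p ^+ 4 * m ^+ 2)^-1.
  by field; rewrite !gt_eqF.
have -> : (4 * p ^+ 2 * m)^-1 ^+ 2 = 16^-1 * (p ^+ 4 * m ^+ 2)^-1.
  by field; rewrite !gt_eqF.
by rewrite ltr_pM2r; [lra|rewrite invr_gt0 mulr_gt0// exprn_gt0].
Qed.

Definition two_slabs (a b : 'cV[scal R k]_n.+1) : set (borel_vec R k n.+1) :=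
  [set z | abs_scal (inner a z) <= slab_radius] `|`
  [set z | abs_scal (inner b z) <= slab_radius].

Lemma slab_radius_ge0 : 0 <= slab_radius.
Proof. by rewrite invr_ge0. Qed.

Lemma cross_radius_gt0 : 0 < cross_radius.
Proof.
have p0 : 0 < M%:R :> R by rewrite ltr0n.
rewrite invr_gt0; apply: mulr_gt0; last exact: exprn_gt0.
by apply: mulr_gt0; [rewrite ltr0n|rewrite exprn_gt0].
Qed.

Lemma measurable_two_slabs a b : measurable (two_slabs a b).
Proof. by apply: measurableU; apply: measurable_slab; exact: slab_radius_ge0. Qed.

Lemma two_slabs_small a b :
  @unit_sphere R k n.+1 a -> @unit_sphere R k n.+1 b ->
  (mu (two_slabs a b) <= (2 * M%:R^-1)%:E)%E.
Proof.
move=> a1 b1; rewrite (le_trans (measureU2 _ _ _))//.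
- by apply: measurable_slab; exact: slab_radius_ge0.
- by apply: measurable_slab; exact: slab_radius_ge0.
- have -> : 2 * M%:R^-1 = M%:R^-1 + M%:R^-1 :> R by ring.
  by rewrite EFinD leeD//; exact: slab_small.
Qed.

End CrossSmall.

(** Over the reals [cross a b z] is a product, hence small only in one of the two
    slabs. *)
Lemma cross_small_real (R : realType) (n M : nat)
    (mu : probability (borel_vec R RealScalars n.+1) R) a b :
  (0 < M)%N -> rotation_invariant mu ->
  @unit_sphere R RealScalars n.+1 a -> @unit_sphere R RealScalars n.+1 b ->
  (mu [set z | (`|cross a b z| <= cross_radius R n M)%R] <= (4 / M%:R)%:E)%E.
Proof.
move=> M0 mu_inv a1 b1.
have sub : [set z | `|cross a b z| <= cross_radius R n M] `<=` two_slabs M a b.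
  move=> z abz; apply: contrapT => nz.
  have za : slab_radius R n M < abs_scal (inner a z).
    by rewrite ltNge; apply/negP => h; apply: nz; left.
  have zb : slab_radius R n M < abs_scal (inner b z).
    by rewrite ltNge; apply/negP => h; apply: nz; right.
  move: abz => /= abz.
  have d0 := slab_radius_ge0 R n M.
  have : slab_radius R n M ^+ 2 < `|cross a b z|.
    by rewrite expr2 [X in _ < X]normrM; exact: ltr_pM.
  have e0 := ltW (cross_radius_gt0 R n M0).
  have M1 : 1 <= M%:R ^+ 4 :> R by rewrite exprn_ege1// ler1n.
  have := cross_radius_slab R n M0.
  have : cross_radius R n M <= cross_radius R n M * M%:R ^+ 4 by rewrite ler_peMr.
  lra.
apply: le_trans (le_trans (two_slabs_small M0 mu_inv a1 b1) _).
  apply: le_measure; rewrite ?inE//; first exact: measurable_cross.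
  exact: measurable_two_slabs.
by rewrite lee_fin ler_wpM2r ?invr_ge0// ler_nat.
Qed.

Section LineRotation.
Variables (R : realType) (k : scalar_kind) (n : nat).
Local Notation F := (scal R k).
Local Notation V := 'cV[F]_n.
Implicit Types (u : F) (a b x z : V).

Definition line_rotation u a : 'M[F]_n := rank_one_update (conj_scal u - 1) a.

Lemma line_rotation_unitary u a :
  abs_scal u = 1 -> @unit_sphere R k n a -> unitary (line_rotation u a).
Proof.
move=> u1 /unit_sphere_inner a1; apply: rank_one_update_unitary.
have uu : u * conj_scal u = 1 by rewrite mul_conj u1 expr1n emb1.
rewrite a1 rmorphB rmorph1/= conj_scalK.
by rewrite -[RHS](subrr 1) -[X in _ = X - _]uu; ring.
Qed.

Lemma inner_line_rotation u a x z :
  inner x (line_rotation u a *m z) =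
  inner x z + (u - 1) * inner x a * inner a z.
Proof. by rewrite inner_rank_one_update rmorphB rmorph1/= conj_scalK. Qed.

(** Only the component of [b] orthogonal to [a] interferes with the phase. *)
Lemma cross_line_rotation u a b z :
  abs_scal u = 1 -> @unit_sphere R k n a -> im (inner a b) = 0 ->
  let alpha := re (inner a b) in
  cross a b (line_rotation u a *m z) =
  alpha * abs_scal (inner a z) ^+ 2 +
  re (u * (inner a z * conj_scal (inner b z - emb k alpha * inner a z))).
Proof.
move=> u1 a1 ab0 alpha.
have ab : inner b a = emb k alpha.
  by rewrite -inner_conj; apply: scal_ext; rewrite !scalE ?ab0 ?oppr0.
have uu : re u ^+ 2 + im u ^+ 2 = 1 by rewrite -abs_sqr u1 expr1n.
rewrite /cross !inner_line_rotation (unit_sphere_inner a1) ab.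
rewrite -[alpha * _]mulr1 -uu abs_sqr !scalE; ring.
Qed.

End LineRotation.

(** Rational points of the circle, so that the parameters can be integers. *)
Definition circle (R : realType) (t : R) : scal R ComplexScalars :=
  Complex ((1 - t ^+ 2) / (1 + t ^+ 2)) (2 * t / (1 + t ^+ 2)).

Lemma circle_den_neq0 (R : realType) (t : R) : 1 + t ^+ 2 != 0.
Proof. by rewrite gt_eqF// ltr_pwDl// sqr_ge0. Qed.

Lemma re_circle (R : realType) (t : R) :
  re (circle t) = (1 - t ^+ 2) / (1 + t ^+ 2).
Proof. by []. Qed.

Lemma im_circle (R : realType) (t : R) : im (circle t) = 2 * t / (1 + t ^+ 2).
Proof. by []. Qed.

Lemma circle_unit (R : realType) (t : R) : abs_scal (circle t) = 1.
Proof.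
apply/eqP; rewrite -(@eqrXn2 _ 2) ?abs_ge0// expr1n abs_sqr re_circle im_circle.
apply/eqP.
by field; exact: circle_den_neq0.
Qed.

Lemma re_circleM (R : realType) (t : R) X :
  (1 + t ^+ 2) * re (circle t * X) = re X * (1 - t ^+ 2) - im X * (2 * t).
Proof.
rewrite reM re_circle im_circle.
by move: (re X) (im X) => p q; field; exact: circle_den_neq0.
Qed.

Section ComplexCrossSmall.
Variables (R : realType) (n M : nat).
Local Notation F := (scal R ComplexScalars).
Local Notation V := 'cV[F]_n.+1.
Local Notation E := (borel_vec R ComplexScalars n.+1).

(** On the orbit of [z] under the rotations of the line of [a], three small values
    of [cross a b] would make all three coefficients small, hence also
    [|<a, z>| |<b, z>|]. *)
Lemma card_small_rotations (a b z : V) : (0 < M)%N ->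
  @unit_sphere R ComplexScalars n.+1 a -> im (inner a b) = 0 ->
  (#|[pred t : 'I_M |
      `[< ([set y | (`|cross a b (line_rotation (circle (t : nat)%:R) a *m y)| <=
              cross_radius R n M)%R] `\` two_slabs M a b) z >]]| <= 2)%N.
Proof.
move=> M0 a1 ab0; rewrite leqNgt; apply/negP => /card_gt2P[x [y [w [[hx hy hw]]]]].
move: hx hy hw => /asboolP[fx nz] /asboolP[fy _] /asboolP[fw _] [xy yw wx].
have za : slab_radius R n M < abs_scal (inner a z).
  by rewrite ltNge; apply/negP => h; apply: nz; left.
have zb : slab_radius R n M < abs_scal (inner b z).
  by rewrite ltNge; apply/negP => h; apply: nz; right.
have dist (i j : 'I_M) := @natr_dist_ge1 R i j.
have range (i : 'I_M) : 0 <= ((i : nat)%:R : R) <= M%:R.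
  by rewrite ler0n ler_nat ltnW.
have M1 : 1 <= M%:R :> R by rewrite ler1n.
have xw : x != w by rewrite eq_sym.
pose alpha := re (inner a b).
pose X := inner a z * conj_scal (inner b z - emb ComplexScalars alpha * inner a z).
have fE (t : R) : (1 + t ^+ 2) * cross a b (line_rotation (circle t) a *m z) =
    alpha * abs_scal (inner a z) ^+ 2 * (1 + t ^+ 2) +
    re X * (1 - t ^+ 2) - im X * (2 * t).
  rewrite (cross_line_rotation z (circle_unit t) a1 ab0) mulrDr re_circleM.
  by rewrite [_ * (alpha * _)]mulrC addrA.
have small := circle_interpolation fE
  (dist _ _ xy) (dist _ _ xw) (dist _ _ yw) (range x) (range y) (range w) M1 fx fy fw.
have d0 := slab_radius_ge0 R n M.
have : slab_radius R n M ^+ 2 < abs_scal (inner a z) * abs_scal (inner b z).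
  by rewrite expr2 ltr_pM.
have := cross_radius_slab R n M0.
suff : abs_scal (inner a z) * abs_scal (inner b z) <=
    `|alpha * abs_scal (inner a z) ^+ 2| + `|re X| + `|im X| by lra.
rewrite -addrA (le_trans _ (lerD (lexx _) (abs_le_re_im X)))//.
have -> : abs_scal (inner a z) * abs_scal (inner b z) =
    abs_scal (emb ComplexScalars (alpha * abs_scal (inner a z) ^+ 2) + X).
  rewrite -[abs_scal (inner b z)]abs_conj -absM; congr abs_scal.
  by rewrite embM -mul_conj /X rmorphB rmorphM/= conj_emb; ring.
by rewrite (le_trans (absD _ _))// abs_emb.
Qed.

(** The events of being small at the [M] rotated copies of [z] all have the same
    mass, and off the two slabs at most two of them occur at once. *)
Lemma cross_small_complex (mu : probability E R) a b :
  (0 < M)%N -> rotation_invariant mu ->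
  @unit_sphere R ComplexScalars n.+1 a -> @unit_sphere R ComplexScalars n.+1 b ->
  im (inner a b) = 0 ->
  (mu [set z | (`|cross a b z| <= cross_radius R n M)%R] <= (4 / M%:R)%:E)%E.
Proof.
move=> M0 mu_inv a1 b1 ab0; set A : set E := [set z | _].
have mA : measurable A by exact: measurable_cross.
pose C (t : 'I_M) : set E :=
  [set z | `|cross a b (line_rotation (circle (t : nat)%:R) a *m z)| <= cross_radius R n M].
have mC t : measurable (C t).
  rewrite /C /cross; under eq_set do rewrite !inner_line_rotation -!innerZl -!innerDl.
  exact: measurable_cross.
have muC t : mu (C t) = mu A.
  by rewrite -[RHS](mu_inv.2 (line_rotation (circle (t : nat)%:R) a))//;
    exact: line_rotation_unitary (circle_unit _) a1.
have mW := @measurable_two_slabs R ComplexScalars n M a b.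
pose B t := C t `\` two_slabs M a b.
have mB t : measurable (B t) by exact: measurableD.
have sumB : (\sum_t mu (B t) <= 2%:R%:E)%E.
  have mS : measurable (@unit_sphere R ComplexScalars n.+1 : set E).
    exact: measurable_unit_sphere.
  apply: (double_counting mB mS mu_inv.1) => z z1.
  exact: card_small_rotations.
have AB t : (mu A <= mu (B t) + (2 / M%:R)%:E)%E.
  rewrite -(muC t); apply: (@le_trans _ _ (mu (B t `|` two_slabs M a b))).
    apply: le_measure; rewrite ?inE//; first exact: measurableU.
    by move=> z Cz; have [Wz|Wz] := pselect (two_slabs M a b z); [right|left].
  rewrite (le_trans (measureU2 _ _ _))// leeD2l//.
  exact: (two_slabs_small M0 mu_inv a1 b1).
have finE (D : set E) : measurable D -> exists2 p, mu D = p%:E & true.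
  by move=> mD; exists (fine (mu D)); rewrite // fineK// fin_num_measure.
have [p Ap _] := finE _ mA.
have /choice[q Bq] : forall t, exists r, mu (B t) = r%:E.
  by move=> t; have [r] := finE _ (mB t); exists r.
have sumq : \sum_t q t <= 2.
  by move: sumB; rewrite (eq_bigr (fun t => (q t)%:E)) => [|t _ //]; rewrite sumEFin lee_fin.
have pq t : p - 2 / M%:R <= q t.
  by have := AB t; rewrite Ap Bq -EFinD lee_fin lerBlDr.
have M0' : 0 < M%:R :> R by rewrite ltr0n.
have : \sum_(t < M) (p - 2 / M%:R) <= 2.
  by apply: le_trans sumq; apply: ler_sum => t _.
rewrite sumr_const card_ord -[leLHS]mulr_natr mulrBl divfK ?gt_eqF// => h.
by rewrite Ap lee_fin ler_pdivlMr//; lra.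
Qed.

End ComplexCrossSmall.

Lemma cross_small (R : realType) (k : scalar_kind) (n M : nat)
    (mu : probability (borel_vec R k n.+1) R) a b :
  (0 < M)%N -> rotation_invariant mu ->
  @unit_sphere R k n.+1 a -> @unit_sphere R k n.+1 b -> im (inner a b) = 0 ->
  (mu [set z | (`|cross a b z| <= cross_radius R n M)%R] <= (4 / M%:R)%:E)%E.
Proof.
case: k mu a b => mu a b M0 mu_inv a1 b1 ab0; first exact: cross_small_real.
exact: cross_small_complex.
Qed.

(** * Covering the pairs of unit vectors *)

Definition net (n K : nat) : finType :=
  {ffun 'I_n -> 'I_(2 * K).+1 * 'I_(2 * K).+1 * ('I_(2 * K).+1 * 'I_(2 * K).+1)}.

Lemma card_net n K : #|net n K| = ((2 * K).+1 ^ (4 * n))%N.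
Proof. by rewrite card_ffun !card_prod !card_ord !mulnn -!expnM mulnA. Qed.

Section Covering.
Variables (R : realType) (k : scalar_kind) (n : nat).
Local Notation F := (scal R k).
Local Notation V := 'cV[F]_n.

Lemma crossBl (a b a' b' z : V) :
  cross a b z - cross a' b' z = cross (a - a') b z + cross a' (b - b') z.
Proof. by rewrite /cross !innerBl !scalE; ring. Qed.

Definition cell (K : nat) (r : R) : 'I_(2 * K).+1 :=
  inord (Num.truncn ((r + 1) * K%:R)).

Lemma cell_close K (r s : R) : (0 < K)%N -> `|r| <= 1 -> `|s| <= 1 ->
  cell K r = cell K s -> `|r - s| <= K%:R^-1.
Proof.
move=> K0; rewrite !ler_norml => /andP[r0 r1] /andP[s0 s1] rs.
have K0' : 0 < K%:R :> R by rewrite ltr0n.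
have cellP (x : R) : -1 <= x -> x <= 1 ->
    (cell K x : nat)%:R <= (x + 1) * K%:R < (cell K x : nat)%:R + 1.
  move=> x0 x1; have x2 : 0 <= (x + 1) * K%:R by apply: mulr_ge0; lra.
  rewrite inordK; last first.
    rewrite ltnS -(ler_nat R) natrM.
    apply: (@le_trans _ _ ((x + 1) * K%:R)); first by rewrite truncn_le.
    by apply: ler_wpM2r; lra.
  by rewrite natr1; exact: truncn_itv.
have := cellP _ r0 r1; have := cellP _ s0 s1; rewrite rs.
move: (nat_of_ord _)%:R => c /andP[sc cs] /andP[rc cr].
have [h1 h2] : (r - s) * K%:R <= 1 /\ (s - r) * K%:R <= 1.
  by rewrite !mulrBl; split; lra.
by apply/andP; split; [rewrite lerNl opprB|]; rewrite -div1r ler_pdivlMr.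
Qed.

Definition cells (K : nat) (a b : V) : net n K :=
  [ffun j => (cell K (re (a j ord0)), cell K (im (a j ord0)),
    (cell K (re (b j ord0)), cell K (im (b j ord0))))].

Lemma abs_inner_close K (a a' z : V) : (0 < K)%N ->
  @unit_sphere R k n a -> @unit_sphere R k n a' -> @unit_sphere R k n z ->
  (forall j, cell K (re (a j ord0)) = cell K (re (a' j ord0)) /\
             cell K (im (a j ord0)) = cell K (im (a' j ord0))) ->
  abs_scal (inner (a - a') z) <= n%:R * (2 / K%:R).
Proof.
move=> K0 a1 a1' z1 aa'; rewrite (le_trans (abs_inner_le _ z1))//.
rewrite mulr_natl -[n in leRHS]card_ord -sumr_const; apply: ler_sum => j _.
rewrite !mxE (le_trans (abs_le_re_im _))// !raddfB.
have [re_j im_j] := aa' j.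
have -> : 2 / K%:R = K%:R^-1 + K%:R^-1 :> R by ring.
by apply: lerD; apply: (cell_close K0) => //; rewrite ?(le_trans (abs_re _))//
  ?(le_trans (abs_im _))// unit_sphere_le1.
Qed.

Lemma cross_close K (a b a' b' z : V) : (0 < K)%N ->
  @unit_sphere R k n a -> @unit_sphere R k n b ->
  @unit_sphere R k n a' -> @unit_sphere R k n b' -> @unit_sphere R k n z ->
  cells K a b = cells K a' b' ->
  `|cross a b z - cross a' b' z| <= 4 * n%:R ^+ 2 / K%:R.
Proof.
move=> K0 a1 b1 a1' b1' z1 /ffunP ab.
rewrite crossBl (le_trans (ler_normD _ _))//.
have ca j : cell K (re (a j ord0)) = cell K (re (a' j ord0)) /\
            cell K (im (a j ord0)) = cell K (im (a' j ord0)).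
  by have := ab j; rewrite !ffunE => -[-> -> _ _].
have cb j : cell K (re (b j ord0)) = cell K (re (b' j ord0)) /\
            cell K (im (b j ord0)) = cell K (im (b' j ord0)).
  by have := ab j; rewrite !ffunE => -[_ _ -> ->].
have -> : 4 * n%:R ^+ 2 / K%:R =
  n%:R * (2 / K%:R) * n%:R + n%:R * (n%:R * (2 / K%:R)) :> R by ring.
apply: lerD; rewrite (le_trans (abs_cross _ _ _))//; apply: ler_pM;
  by rewrite ?abs_ge0 ?(abs_inner_close K0)// abs_inner_unit_le.
Qed.

End Covering.

(** With this many cells per unit length, [cross_close] has the error
    [4 n^2 / mesh = cross_radius]. *)
Definition mesh (n M : nat) : nat := 8000 * n.+1 ^ 6 * M ^ 6.

Lemma mesh_gt0 n M : (0 < M)%N -> (0 < mesh n M)%N.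
Proof. by move=> M0; rewrite /mesh 2!muln_gt0 !expn_gt0 M0. Qed.

(** Pairs in a common cell have close values of [cross], so the event for one
    representative pair accounts for the whole cell. *)
Lemma cross_cover (R : realType) (k : scalar_kind) (n M : nat) : (0 < M)%N ->
  exists Q : net n.+1 (mesh n M) -> set (borel_vec R k n.+1),
  [/\ forall i, measurable (Q i),
      forall i (mu : probability (borel_vec R k n.+1) R), rotation_invariant mu ->
        (mu (Q i) <= (4 / M%:R)%:E)%E &
      forall a b, @unit_sphere R k n.+1 a -> @unit_sphere R k n.+1 b ->
        im (inner a b) = 0 ->
        exists i, forall z, @unit_sphere R k n.+1 z -> cross a b z = 0 -> Q i z].
Proof.
move=> M0; set K := mesh n M.
have K0 : (0 < K)%N by exact: mesh_gt0.
have Keps : 4 * n.+1%:R ^+ 2 / K%:R = cross_radius R n M.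
  rewrite /K /mesh /cross_radius 2!natrM !natrX.
  have M0' : M%:R != 0 :> R by rewrite pnatr_eq0 -lt0n.
  have n0 : n.+1%:R != 0 :> R by rewrite pnatr_eq0.
  by move: (M%:R) (n.+1%:R) M0' n0 => x y x0 y0; field; rewrite x0 y0.
pose adm (p : 'cV[scal R k]_n.+1 * 'cV[scal R k]_n.+1) :=
  [/\ unit_sphere p.1, unit_sphere p.2 & im (inner p.1 p.2) = 0].
have /choice[Q QP] : forall i, exists Qi : set (borel_vec R k n.+1),
  [/\ measurable Qi, forall mu : probability (borel_vec R k n.+1) R,
        rotation_invariant mu -> (mu Qi <= (4 / M%:R)%:E)%E &
      forall p, adm p -> cells K p.1 p.2 = i ->
        forall z, unit_sphere z -> cross p.1 p.2 z = 0 -> Qi z].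
  move=> i; have [[q [q1 q2 q3] qi]|nex] :=
    pselect (exists2 q, adm q & cells K q.1 q.2 = i).
    exists [set z | `|cross q.1 q.2 z| <= cross_radius R n M]; split.
    - exact: measurable_cross.
    - by move=> mu mu_inv; exact: cross_small.
    - move=> p [p1 p2 _] pi z z1 pz; rewrite /mkset -Keps -[cross _ _ _]subr0 -pz.
      by apply: cross_close => //; rewrite qi pi.
  exists set0; split => // [mu _|p padm pi].
    by rewrite measure0 lee_fin divr_ge0.
  by case: nex; exists p.
exists Q; split=> [i|i mu|a b a1 b1 ab].
- by have [] := QP i.
- by have [_ + _] := QP i; apply.
- exists (cells K a b); have [_ _] := QP (cells K a b).
  by move=> /(_ (a, b)); apply.
Qed.

(** The net has [O (M ^ (24 n))] cells: [4 n] real coordinates, each cut at scale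
    [M ^ -6]. So [m > 24 n] measurements, each passed with probability [4 / M],
    bring the union bound down to [O (1 / M)]. *)
Lemma net_beats_small_ball (R : realType) (n m : nat) (e : R) :
  (24 * n.+1 < m)%N -> 0 < e ->
  exists2 M, (0 < M)%N &
    #|net n.+1 (mesh n M)|%:R * (4 / M%:R) ^+ m <= e.
Proof.
move=> nm e0.
(* 24000 is 3 times the constant of [mesh], from [2 K + 1 <= 3 K]. *)
pose D : R := (24000 * n.+1 ^ 6)%:R ^+ (4 * n.+1) * 4 ^+ m.
have D0 : 0 <= D by rewrite mulr_ge0 ?exprn_ge0.
have [M MD] : exists M, D / e < M.+1%:R.
  by exists (Num.truncn (D / e)); rewrite truncnS_gt.
exists M.+1 => //; set N := M.+1; have N0 : 0 < N%:R :> R by rewrite ltr0n.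
have N1 : 1 <= N%:R :> R by rewrite ler1n.
have netle : #|net n.+1 (mesh n N)|%:R <=
    (24000 * n.+1 ^ 6)%:R ^+ (4 * n.+1) * N%:R ^+ (24 * n.+1) :> R.
  rewrite card_net natrX.
  have -> : N%:R ^+ (24 * n.+1) = (N ^ 6)%:R ^+ (4 * n.+1) :> R.
    by rewrite natrX -exprM mulnA.
  rewrite -exprMn -natrM; apply: lerXn2r; rewrite ?nnegrE ?ler0n// ler_nat.
  have : (0 < mesh n N)%N by exact: mesh_gt0.
  have -> : (24000 * n.+1 ^ 6 * N ^ 6 = 3 * mesh n N)%N by rewrite /mesh !mulnA.
  by move: (mesh n N) => x x0; rewrite [(3 * x)%N]mulSn -add1n leq_add2r.
rewrite (@le_trans _ _ (D / N%:R))//; last by rewrite ler_pdivrMr// mulrC -ler_pdivrMr// ltW.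
apply: le_trans (_ : (24000 * n.+1 ^ 6)%:R ^+ (4 * n.+1) * N%:R ^+ (24 * n.+1) *
   (4 / N%:R) ^+ m <= _).
  by rewrite ler_wpM2r// exprn_ge0// divr_ge0.
rewrite exprMn exprVn /D -!mulrA ler_wpM2l ?exprn_ge0//.
rewrite mulrCA ler_wpM2l ?exprn_ge0//.
rewrite ler_pdivrMr ?exprn_gt0// mulrC ler_pdivlMr// -exprSr.
by rewrite ler_weXn2l.
Qed.

(** * Recovery with probability one *)

(** In dimension one [cross a b] is constant on the sphere, equal to [<a, b>],
    which is real of modulus one. *)
Lemma separating_dim1 (R : realType) (k : scalar_kind) (I : Type)
    (z : I -> 'cV[scal R k]_1) (i : I) :
  @unit_sphere R k 1 (z i) -> separating z.
Proof.
move=> z1 a b a1 b1 ab0; exists i.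
have abs1 (x : 'cV[scal R k]_1) : @unit_sphere R k 1 x -> abs_scal (x ord0 ord0) = 1.
  rewrite /unit_sphere/= big_ord1 => /eqP; rewrite -[X in _ == X](expr1n _ 2).
  by rewrite eqrXn2 ?abs_ge0// => /eqP.
move: ab0 (abs1 _ a1) (abs1 _ b1) (abs1 _ z1); rewrite /cross /inner !big_ord1.
move: (a _ _) (b _ _) (z i _ _) => p q r pq p1 q1 r1.
have -> : p * conj_scal r * conj_scal (q * conj_scal r) =
    p * conj_scal q * (r * conj_scal r).
  by rewrite rmorphM/= conj_scalK; ring.
rewrite mul_conj r1 expr1n emb1 mulr1; apply/eqP => pq0.
have /(congr1 (fun x => x ^+ 2)) := absM p (conj_scal q).
rewrite abs_sqr pq0 pq abs_conj p1 q1 mulr1 expr0n addr0 expr1n.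
by move/eqP; rewrite eq_sym oner_eq0.
Qed.

Section Probability.
Variables (d : measure_display) (Om : measurableType d) (R : realType).
Variables (P : probability Om R) (k : scalar_kind) (n m : nat).
Variable Z : 'I_m -> {RV P >-> borel_vec R k n}.
Hypotheses (Zind : mutually_independent Z) (Zunif : forall i, uniform_on_sphere (Z i)).

Definition on_sphere : set Om :=
  \bigcap_(i in [set` finset.setTfor 'I_m]) (Z i @^-1` @unit_sphere R k n).

Lemma measurable_preimage i (B : set (borel_vec R k n)) :
  measurable B -> measurable (Z i @^-1` B).
Proof. by move=> mB; rewrite -[X in measurable X]setTI; exact: measurable_funPT. Qed.

Lemma measurable_all (B : 'I_m -> set (borel_vec R k n)) :
  (forall i, measurable (B i)) ->
  measurable (\bigcap_(i in [set` finset.setTfor 'I_m]) (Z i @^-1` B i)).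
Proof.
move=> mB; apply: fin_bigcap_measurable => // i _; exact: measurable_preimage.
Qed.

Lemma measurable_on_sphere : measurable on_sphere.
Proof. by apply: measurable_all => i; exact: measurable_unit_sphere. Qed.

Lemma on_sphere_full : P on_sphere = 1%E.
Proof.
rewrite /on_sphere Zind => [|_]; last exact: measurable_unit_sphere.
by rewrite big1// => i _; exact: (Zunif i).1.
Qed.

End Probability.

(** The error is arbitrary: for fixed [n] and [m] the scale [M] of the net is free. *)
Lemma separating_whp (R : realType) (k : scalar_kind) (n m : nat) (e : R)
    (d : measure_display) (Om : measurableType d) (P : probability Om R)
    (Z : 'I_m -> {RV P >-> borel_vec R k n.+1}) :
  (24 * n.+1 < m)%N -> 0 < e -> mutually_independent Z ->
  (forall i, uniform_on_sphere (Z i)) ->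
  exists E : set Om, [/\ measurable E, ((1 - e)%:E <= P E)%E &
    forall w, E w -> separating (fun i => Z i w)].
Proof.
move=> nm e0 Zind Zunif.
have [M M0 MD] := net_beats_small_ball nm e0.
have [Q [mQ muQ Qcover]] := cross_cover R k n M0.
pose G i : set Om := \bigcap_(l in [set` finset.setTfor 'I_m]) (Z l @^-1` Q i).
have mG i : measurable (G i) by exact: measurable_all.
have PG i : (P (G i) <= ((4 / M%:R) ^+ m)%:E)%E.
  have /choice[p Pp] : forall l, exists p, distribution P (Z l) (Q i) = p%:E.
    by move=> l; exists (fine (distribution P (Z l) (Q i))); rewrite fineK// fin_num_measure.
  rewrite /G Zind// (eq_bigr (fun l => (p l)%:E)) => [|l _]; last exact: Pp.
  rewrite prodEFin lee_fin -[m in leRHS]card_ord -cardsT -prodr_const.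
  apply: ler_prod => l _; rewrite -!lee_fin -Pp measure_ge0/=.
  exact: muQ (Zunif l).
pose Bad := \big[setU/set0]_i G i.
have mBad : measurable Bad by exact: bigsetU_measurable.
have PBad : (P Bad <= e%:E)%E.
  apply: le_trans (union_bound P mG) _.
  apply: (@le_trans _ _ (\sum_(i : net n.+1 (mesh n M))
      ((4 / M%:R) ^+ m)%:E)%E); first by apply: lee_sum.
  by rewrite sumEFin lee_fin sumr_const -[leLHS]mulr_natl; exact: MD.
have mS : measurable (on_sphere Z) by exact: measurable_on_sphere.
exists (on_sphere Z `\` Bad); split.
- exact: measurableD.
- have h : (P ((on_sphere Z `\` Bad) `|` Bad) <= P (on_sphere Z `\` Bad) + P Bad)%E.
    by apply: measureU2 => //; exact: measurableD.
  rewrite EFinB leeBlDr// -(on_sphere_full Zind Zunif).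
  apply: (@le_trans _ _ (P ((on_sphere Z `\` Bad) `|` Bad))).
    apply: le_measure; rewrite ?inE//; first by apply: measurableU => //; exact: measurableD.
    by move=> w Sw; have [Bw|Bw] := pselect (Bad w); [right|left].
  by rewrite (le_trans h)// leeD2l.
- move=> w [Sw nBad] a b a1 b1 ab0; apply: contrapT => /forallNP nsep.
have zero l : cross a b (Z l w) = 0 by apply/eqP/negPn/negP/nsep.
have [i Qi] := Qcover a b a1 b1 ab0.
apply: nBad; rewrite /Bad -bigcup_seq; exists i; rewrite /= ?mem_index_enum// => l _.
by apply: Qi => //; apply: Sw => /=; rewrite finset.in_setT.
Qed.

Lemma ln2_ge_half (R : realType) : 2^-1 <= ln 2 :> R.
Proof.
have := @le_ln1Dx R (- 2^-1); have -> : 1 + - 2^-1 = 2^-1 :> R by lra.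
by rewrite lnV ?posrE// => h; have := h ltac:(lra); lra.
Qed.

Theorem corollary2 (R : realType) (k : scalar_kind) :
  exists c gamma : R,
    [/\ 0 < c, 0 < gamma &
      forall n m : nat, (0 < n)%N -> (0 < m)%N ->
      c * n%:R * ln n%:R <= m%:R ->
      forall (x0 : 'cV[scal R k]_n)
        (d : measure_display) (Om : measurableType d) (P : probability Om R)
        (Z : 'I_m -> {RV P >-> borel_vec R k n}),
      mutually_independent Z ->
      (forall i : 'I_m, uniform_on_sphere (Z i)) ->
      (* inner probability: no measurability of the uniqueness event is assumed *)
      exists E : set Om,
        [/\ measurable E,
            ((1 - expR (- (gamma * m%:R / n%:R)))%:E <= P E)%E &
            forall w : Om, E w ->
              [set x : 'cV[scal R k]_n |
                 phaseless_map (fun i => Z i w) x =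
                 phaseless_map (fun i => Z i w) x0] =
              [set u *: x0 | u in @phases R k]]].
Proof.
(* As [ln 2 >= 1/2], [c = 100] gives [m >= 50 n > 24 n] as soon as [n >= 2]; when
   [n = 1] the hypothesis only says [m > 0]. *)
exists 100, 1; split=> [||[//|[|n]] m _ m0 nm x0 d Om P Z Zind Zunif]//.
  exists (on_sphere Z); split.
  - exact: measurable_on_sphere.
  - by rewrite (on_sphere_full Zind Zunif) lee_fin gerBl expR_ge0.
  move=> w Sw; apply: separating_recovery.
  apply: (@separating_dim1 _ _ _ _ (Ordinal m0)).
  by apply: Sw => /=; rewrite finset.in_setT.
have nm' : (24 * n.+2 < m)%N.
  rewrite -(ltr_nat R) natrM; apply: lt_le_trans nm.
  have ln_n : 2^-1 <= ln n.+2%:R :> R.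
    by rewrite (le_trans (ln2_ge_half R))// ler_ln ?posrE ?ltr0n// ler_nat.
  have n2 : 2 <= n.+2%:R :> R by rewrite ler_nat.
  by move: (n.+2%:R) (ln _) n2 ln_n => x y; nra.
have [E [mE PE Esep]] := separating_whp nm'
  (expR_gt0 (- (1 * m%:R / n.+2%:R))) Zind Zunif.
by exists E; split=> // w /Esep; exact: separating_recovery.
Qed.
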